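(* Let $F(\mathbf{w})=\mathbb{E}_{\mathbf{x}\sim\mathcal{X}}[f(\mathbf{w},\mathbf{x})]$ satisfy (PL) with constant $\alpha>0$, (Smooth) with constant $\beta>0$, and (Bounded variance) with constant $V\ge0$; let $F^*=\min_{\mathbf{w}}F(\mathbf{w})$. Let $\eta\in(0,2\beta^{-1})$, $\gamma=\eta\alpha(2-\eta\beta)$, $\Delta=\frac{1}{2\gamma}\eta^2\beta V$, and let $S$ be a positive integer with $S\le\gamma^{-1}$. Run the AdaScale algorithm with scale $S$, constant schedule $\mathrm{lr}(t)=\eta$, and some $T_{\mathrm{SI}}>0$, and let $T$ be its total number of iterations and $\bar r=\frac1T\sum_{t=0}^{T-1}r_t$ its average gain ratio. Then \[ \mathbb{E}[F(\mathbf{w}_T)-F^*]\le(1-\gamma)^{\bar rT}[F(\mathbf{w}_0)-F^*]+\Delta. \]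
   Context: Setting: $\mathcal{X}$ is a distribution over batches; $f(\cdot,\mathbf{x})$ and $F$ are differentiable and $\mathbb{E}_{\mathbf{x}\sim\mathcal{X}}[\nabla_{\mathbf{w}}f(\mathbf{w},\mathbf{x})]=\nabla F(\mathbf{w})$. $\sigma_{\mathbf{g}}^2(\mathbf{w})=\mathrm{tr}\big(\mathrm{cov}_{\mathbf{x}\sim\mathcal{X}}(\nabla_{\mathbf{w}}f(\mathbf{w},\mathbf{x}),\nabla_{\mathbf{w}}f(\mathbf{w},\mathbf{x}))\big)$ and $\mu_{\mathbf{g}}^2(\mathbf{w})=\|\nabla F(\mathbf{w})\|^2$. (PL): $F(\mathbf{w})-F^*\le\frac1{2\alpha}\|\nabla F(\mathbf{w})\|^2$ for all $\mathbf{w}$. (Smooth): $\|\nabla F(\mathbf{w})-\nabla F(\mathbf{w}')\|\le\beta\|\mathbf{w}-\mathbf{w}'\|$. (Bounded variance): $\sigma_{\mathbf{g}}^2(\mathbf{w})\le V$ for all $\mathbf{w}$. AdaScale algorithm (inputs: scale $S$, schedule $\mathrm{lr}$, $T_{\mathrm{SI}}>0$, $\mathbf{w}_0$): set $\tau_0=0$, $t=0$. While $\tau_t<T_{\mathrm{SI}}$: draw $S$ batches $\mathbf{x}^{(1)},\dots,\mathbf{x}^{(S)}\sim\mathcal{X}$ independently of each other and of the past, set $\bar{\mathbf{g}}_t=\frac1S\sum_{i=1}^S\nabla_{\mathbf{w}}f(\mathbf{w}_t,\mathbf{x}^{(i)})$; set the deterministic gain ratio \[ r_t=\frac{\mathbb{E}_{\mathbf{w}_t}[\sigma_{\mathbf{g}}^2(\mathbf{w}_t)+\mu_{\mathbf{g}}^2(\mathbf{w}_t)]}{\mathbb{E}_{\mathbf{w}_t}[\tfrac1S\sigma_{\mathbf{g}}^2(\mathbf{w}_t)+\mu_{\mathbf{g}}^2(\mathbf{w}_t)]}\in[1,S]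 \] (expectation over the distribution of $\mathbf{w}_t$ induced by previous random batches; $r_t:=1$ if the denominator is $0$); set $\eta_t=r_t\cdot\mathrm{lr}(\lfloor\tau_t\rfloor)$, $\mathbf{w}_{t+1}=\mathbf{w}_t-\eta_t\bar{\mathbf{g}}_t$, $\tau_{t+1}=\tau_t+r_t$, $t\leftarrow t+1$. Output the final iterate. Since $r_t\ge1$, the loop terminates after finitely many iterations. *)

(* Defs.v *)
From HB Require Import structures.
From mathcomp Require Import all_boot all_order all_algebra.
From mathcomp Require Import all_classical all_reals all_analysis.
Set Implicit Arguments. Unset Strict Implicit. Unset Printing Implicit Defensive.
Import Order.TTheory GRing.Theory Num.Theory.
Import numFieldNormedType.Exports.
Local Open Scope classical_set_scope.
Local Open Scope ring_scope.

Section AdaScaleDefs.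
Variable R : realType.
Variable d : nat.

Local Notation W := 'rV[R]_d.

Definition dotv (u v : W) : R := \sum_(i < d) u ord0 i * v ord0 i.
Definition sqnorm (u : W) : R := dotv u u.
Definition enorm (u : W) : R := Num.sqrt (sqnorm u).

Definition is_gradient (F : W -> R) (gF : W -> W) : Prop :=
  forall w : W, differentiable F w /\ forall h : W, 'd F w h = dotv (gF w) h.

(* Coordinates of a vector as a d-tuple (d.-tuple R carries the product
   sigma-algebra generated by the coordinates). *)
Definition rv2tuple (u : W) : d.-tuple R := [tuple u ord0 i | i < d].
Definition tuple2rv (t : d.-tuple R) : W := \row_(i < d) tnth t i.

Definition PL_cond (F : W -> R) (gF : W -> W) (Fstar alpha : R) : Prop :=
  forall w : W, F w - Fstar <= (2 * alpha)^-1 * sqnorm (gF w).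

Definition smooth_cond (gF : W -> W) (beta : R) : Prop :=
  forall w w' : W, enorm (gF w - gF w') <= beta * enorm (w - w').

Section Batches.
Variables (dX : measure_display) (X : measurableType dX) (PX : probability X R).

(* sigma_g^2(w) = tr cov_{x ~ PX}(grad f(w,x), grad f(w,x)) *)
Definition sigma2 (g : W -> X -> W) (w : W) : \bar R :=
  (\sum_(i < d) covariance PX (fun x => g w x ord0 i) (fun x => g w x ord0 i))%E.

Definition mu2 (gF : W -> W) (w : W) : R := sqnorm (gF w).

Variables (dO : measure_display) (Omega : measurableType dO) (P : probability Omega R).

Definition iid_batches (S : nat) (xb : nat -> 'I_S -> Omega -> X) : Prop :=
  (forall t i, measurable_fun setT (xb t i)) /\
  forall (s : seq (nat * 'I_S)) (A : nat * 'I_S -> set X),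
    uniq s -> (forall k, measurable (A k)) ->
    P (\big[setI/setT]_(k <- s) (xb k.1 k.2 @^-1` A k)) =
    (\prod_(k <- s) PX (A k))%E.

(* Gain ratio from the two expectations (numerator, denominator);
   r := 1 when the denominator is 0 (paper's convention) and also, by
   convention, when it is +oo (case that does not arise). *)
Definition gain_ratio (num den : \bar R) : R :=
  if ((0 < den) && (den < +oo))%E then fine num / fine den else 1.

Definition adascale_r (S : nat) (g : W -> X -> W) (gF : W -> W)
    (wt : Omega -> W) : R :=
  gain_ratio
    (\int[P]_om (sigma2 g (wt om) + (mu2 gF (wt om))%:E))%E
    (\int[P]_om (sigma2 g (wt om) * (S%:R^-1)%:E + (mu2 gF (wt om))%:E))%E.

Definition gbar (S : nat) (g : W -> X -> W) (xb : nat -> 'I_S -> Omega -> X)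
    (t : nat) (w : W) (om : Omega) : W :=
  S%:R^-1 *: \sum_(i < S) g w (xb t i om).

Fixpoint adascale_state (S : nat) (lr : nat -> R) (g : W -> X -> W)
    (gF : W -> W) (xb : nat -> 'I_S -> Omega -> X) (w0 : W) (t : nat)
    : (Omega -> W) * R :=
  match t with
  | 0 => (fun _ => w0, 0)
  | t'.+1 =>
      let st := adascale_state lr g gF xb w0 t' in
      let r := adascale_r S g gF st.1 in
      (fun om => st.1 om - (r * lr (Num.truncn st.2)) *: gbar g xb t' (st.1 om) om,
       st.2 + r)
  end.

Definition adascale_w S lr g gF xb w0 t : Omega -> W :=
  (@adascale_state S lr g gF xb w0 t).1.
Definition adascale_tau S lr g gF xb w0 t : R :=
  (@adascale_state S lr g gF xb w0 t).2.
Definition adascale_rt S lr g gF xb w0 t : R :=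
  adascale_r S g gF (@adascale_w S lr g gF xb w0 t).

(* T is the total number of iterations of the loop "while tau_t < T_SI". *)
Definition adascale_stops_at S lr g gF xb w0 (TSI : R) (T : nat) : Prop :=
  TSI <= @adascale_tau S lr g gF xb w0 T /\
  forall t, (t < T)%N -> @adascale_tau S lr g gF xb w0 t < TSI.

End Batches.
End AdaScaleDefs.

(* Main.v *)
Require Import Defs.
From HB Require Import structures.
From mathcomp Require Import all_boot all_order all_algebra.
From mathcomp Require Import all_classical all_reals all_analysis.
From mathcomp Require Import measurable_realfun ring lra.
Import Order.TTheory GRing.Theory Num.Theory.
Import numFieldNormedType.Exports.
Local Open Scope classical_set_scope.
Local Open Scope ring_scope.

(** Write D_t = E[F(w_t) - F*], m = E|grad F(w_t)|^2 and s = E[sigma_g^2(w_t)].  The noise of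
    each batch gradient is centered and orthogonal to every square-integrable variable that is
    measurable for the other batches, so E|gbar_t|^2 = m + s/S, and smoothness gives
      D_{t+1} <= D_t - r eta m + (beta/2) (r eta)^2 (m + s/S),   r = r_t.
    The gain ratio is exactly such that r (m + s/S) = m + s; with (PL), m >= 2 alpha D_t, and
    s <= V this becomes D_{t+1} - Delta <= (1 - r gamma) (D_t - Delta).  Since r gamma <= 1
    and 1 - r gamma <= (1 - gamma)^r by Bernoulli, the bound follows by induction on t.  The
    same induction keeps D_t finite, hence also m, because |grad F|^2 <= 2 beta (F - Fstar). *)

(** * Smooth functions *)

Section Gradient.
Context {R : realType} {d : nat}.
Implicit Types (u v w h : 'rV[R]_d) (F : 'rV[R]_d -> R) (gF : 'rV[R]_d -> 'rV[R]_d).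

Lemma dotvDl u v w : dotv (u + v) w = dotv u w + dotv v w.
Proof. by rewrite /dotv -big_split; apply: eq_bigr => i _; rewrite !mxE mulrDl. Qed.

Lemma dotvZl (a : R) u v : dotv (a *: u) v = a * dotv u v.
Proof. by rewrite /dotv mulr_sumr; apply: eq_bigr => i _; rewrite !mxE mulrA. Qed.

Lemma dotvC u v : dotv u v = dotv v u.
Proof. by apply: eq_bigr => i _; rewrite mulrC. Qed.

Lemma dotvDr u v w : dotv w (u + v) = dotv w u + dotv w v.
Proof. by rewrite dotvC dotvDl ![dotv _ w]dotvC. Qed.

Lemma dotvZr (a : R) u v : dotv v (a *: u) = a * dotv v u.
Proof. by rewrite dotvC dotvZl dotvC. Qed.

Lemma dotvNl u v : dotv (- u) v = - dotv u v.
Proof. by rewrite -scaleN1r dotvZl mulN1r. Qed.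

Lemma sqnorm_ge0 u : 0 <= sqnorm u.
Proof. by apply: sumr_ge0 => i _; rewrite -expr2 sqr_ge0. Qed.

Lemma enorm_ge0 u : 0 <= enorm u. Proof. exact: sqrtr_ge0. Qed.

Lemma enorm_sq u : enorm u ^+ 2 = sqnorm u.
Proof. by rewrite sqr_sqrtr ?sqnorm_ge0. Qed.

Lemma enormZ (a : R) u : 0 <= a -> enorm (a *: u) = a * enorm u.
Proof.
move=> a0; rewrite /enorm /sqnorm dotvZl dotvZr mulrA sqrtrM ?mulr_ge0//.
by rewrite -expr2 sqrtr_sqr ger0_norm.
Qed.

Lemma enormN u : enorm (- u) = enorm u.
Proof. by rewrite /enorm /sqnorm dotvNl dotvC dotvNl opprK. Qed.

Lemma dotv_enorm0 u v : enorm u = 0 -> dotv u v = 0.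
Proof.
move=> u0; have su : sqnorm u = 0 by rewrite -enorm_sq u0 expr0n.
rewrite /dotv big1// => i _; suff -> : u ord0 i = 0 by rewrite mul0r.
apply/eqP; rewrite -sqrf_eq0.
move/eqP: su; rewrite psumr_eq0 => [/allP/(_ i)|j _]; last by rewrite -expr2 sqr_ge0.
by rewrite mem_index_enum -expr2 => /(_ isT).
Qed.

(** Cauchy-Schwarz: for nonzero vectors, expand the squared norm of [enorm v *: u - enorm u *: v]
    and divide by twice the product of the norms. *)
Lemma dotv_le_enorm u v : dotv u v <= enorm u * enorm v.
Proof.
have [u0|u0] := eqVneq (enorm u) 0; first by rewrite u0 mul0r dotv_enorm0.
have [v0|v0] := eqVneq (enorm v) 0; first by rewrite v0 mulr0 dotvC dotv_enorm0.
have up : 0 < enorm u by rewrite lt_def u0 enorm_ge0.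
have vp : 0 < enorm v by rewrite lt_def v0 enorm_ge0.
have := sqnorm_ge0 (enorm v *: u - enorm u *: v).
rewrite /sqnorm dotvDl !dotvDr !dotvNl dotvC dotvNl ![dotv _ (- _)]dotvC !dotvNl.
rewrite !dotvZl !dotvZr -!/(sqnorm _) -!enorm_sq [dotv v u]dotvC => H.
have {H} : 0 <= 2 * (enorm u * enorm v) * (enorm u * enorm v - dotv u v) by lra.
by rewrite pmulr_rge0 ?subr_ge0// !mulr_gt0.
Qed.

Lemma is_gradientN F gF : is_gradient F gF -> is_gradient (fun w => - F w) (fun w => - gF w).
Proof.
move=> G w; have [dF eF] := G w; split; first exact: differentiableN.
by move=> h; rewrite (diffN dF) dotvNl -eF.
Qed.

Lemma smooth_condN gF (beta : R) : smooth_cond gF beta -> smooth_cond (fun w => - gF w) beta.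
Proof. by move=> H w w'; rewrite -opprD enormN. Qed.

(** The difference quotients along the line are those of [F] at [w + s *: h] in direction [h]. *)
Lemma is_derive_line F gF w h (s : R) : is_gradient F gF ->
  is_derive s 1 (fun s : R => F (w + s *: h)) (dotv (gF (w + s *: h)) h).
Proof.
move=> G; have [dF eF] := G (w + s *: h).
have eq : (fun t : R => t^-1 *: (((fun s => F (w + s *: h)) \o shift s) (t *: 1) - F (w + s *: h)))
    = (fun t : R => t^-1 *: ((F \o shift (w + s *: h)) (t *: h) - F (w + s *: h))).
  apply/funext => t /=; congr (_ *: (F _ - _)).
  by rewrite [t *: 1]mulr1 scalerDl addrCA.
apply: DeriveDef.
  by rewrite /derivable eq; exact: diff_derivable.
by rewrite /derive eq -/(derive F _ _) deriveE// eF.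
Qed.

(** The descent lemma. Subtract from [F] along the segment its linear part and the quadratic term:
    the rest, [psi], has derivative at most 0 inside the segment by Cauchy-Schwarz and the Lipschitz
    gradient, and the mean value theorem compares its ends. *)
Lemma smooth_upper_bound F gF (beta : R) w h : 0 <= beta ->
    is_gradient F gF -> smooth_cond gF beta ->
  F (w + h) <= F w + dotv (gF w) h + beta / 2 * sqnorm h.
Proof.
move=> b0 G sm.
pose psi (s : R) := F (w + s *: h) - s * dotv (gF w) h - s ^+ 2 * (beta / 2 * sqnorm h).
pose dpsi (s : R) := dotv (gF (w + s *: h)) h - dotv (gF w) h - (2 * s) * (beta / 2 * sqnorm h).
have dpsiP (s : R) : is_derive s 1 psi (dpsi s).
  have ? := @is_derive_line F gF w h s G.
  apply: is_derive_eq; rewrite /dpsi /GRing.scale/=; ring.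
have [//|c] := @MVT R psi dpsi 0 1 ltr01 (fun s _ => dpsiP s).
  by apply: derivable_within_continuous => s _; exact: ex_derive.
rewrite in_itv/= => /andP[c0 c1].
rewrite subr0 mulr1 /psi expr1n expr0n/= !mul0r !subr0 scale1r scale0r addr0 !mul1r => e.
suff : dpsi c <= 0 by lra.
rewrite /dpsi -dotvNl -dotvDl.
have := dotv_le_enorm (gF (w + c *: h) - gF w) h.
have := sm (w + c *: h) w; rewrite (addrC w) addrK enormZ ?(ltW c0)// -enorm_sq.
have := enorm_ge0 h => h0 /(ler_wpM2r h0); nra.
Qed.

(** The lower half is the descent lemma for [- F], whose gradient has the same Lipschitz
    constant. *)
Lemma smooth_error_bound F gF (beta : R) w h : 0 <= beta ->
    is_gradient F gF -> smooth_cond gF beta ->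
  `|F (w + h) - F w - dotv (gF w) h| <= beta / 2 * sqnorm h.
Proof.
move=> b0 G sm; rewrite ler_norml; apply/andP; split.
  have := @smooth_upper_bound _ _ _ w h b0 (is_gradientN _ _ G) (smooth_condN _ _ sm).
  by rewrite dotvNl; lra.
by have := @smooth_upper_bound _ _ _ w h b0 G sm; lra.
Qed.

Lemma sqnorm_gradient_le F gF (beta Fstar : R) w : 0 < beta ->
    is_gradient F gF -> smooth_cond gF beta -> (forall w, Fstar <= F w) ->
  sqnorm (gF w) <= 2 * beta * (F w - Fstar).
Proof.
move=> b0 G sm Fs.
(* This step minimises the quadratic upper bound, and the value of [F] reached is still at least
   [Fstar]. *)
have := @smooth_upper_bound _ _ _ w (- beta^-1 *: gF w) (ltW b0) G sm.
rewrite dotvZr /sqnorm dotvZl dotvZr -/(sqnorm _) => H.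
have := le_trans (Fs _) H => {}H.
have -> : sqnorm (gF w) = 2 * beta * (beta^-1 * sqnorm (gF w) / 2).
  by field; rewrite gt_eqF.
rewrite ler_pM2l ?mulr_gt0//.
suff <- : beta^-1 * sqnorm (gF w) - beta / 2 * (- beta^-1 * (- beta^-1 * sqnorm (gF w)))
    = beta^-1 * sqnorm (gF w) / 2 by lra.
by field; rewrite gt_eqF.
Qed.

(* Expresses [F] as a limit of functions of [gF], from which it inherits measurability. *)
Lemma cvg_gradient_riemann_sum F gF (beta : R) w : 0 <= beta ->
    is_gradient F gF -> smooth_cond gF beta ->
  (fun n : nat => F 0 + \sum_(j < n.+1)
     n.+1%:R^-1 * dotv (gF ((j%:R / n.+1%:R) *: w)) w) @ \oo --> F w.
Proof.
move=> b0 G sm.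
have bnd (n : nat) : `|F w - (F 0 + \sum_(j < n.+1)
     n.+1%:R^-1 * dotv (gF ((j%:R / n.+1%:R) *: w)) w)| <=
     beta / 2 * sqnorm w * n.+1%:R^-1.
  have n0 : n.+1%:R != 0 :> R by rewrite pnatr_eq0.
  (* The increment of [F] telescopes over [n.+1] equal pieces of the segment from 0 to [w]. Each
     piece has a linearisation error of order [1 / n^2], so the total error is of order [1 / n]. *)
  have -> : F w = F 0 + \sum_(j < n.+1)
      (F ((j.+1%:R / n.+1%:R) *: w) - F ((j%:R / n.+1%:R) *: w)).
    rewrite -(big_mkord xpredT (fun j => F ((j.+1%:R / n.+1%:R) *: w) - F ((j%:R / n.+1%:R) *: w))).
    rewrite telescope_sumr// divff// mul0r scale0r scale1r; lra.
  rewrite opprD addrACA subrr add0r -sumrB.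
  apply: le_trans (ler_norm_sum _ _ _) _.
  rewrite (_ : _ * _ = \sum_(j < n.+1) beta / 2 * sqnorm (n.+1%:R^-1 *: w)); last first.
    rewrite sumr_const card_ord /sqnorm dotvZl dotvZr -mulr_natr; field.
    by rewrite addrC natr1.
  apply: ler_sum => j _; rewrite -dotvZr.
  apply: le_trans (@smooth_error_bound F gF beta ((j%:R / n.+1%:R) *: w) (n.+1%:R^-1 *: w) b0 G sm).
  by rewrite -scalerDl -[j.+1%:R]natr1 mulrDl mul1r.
apply/cvgrPdist_le => /= e e0.
have [N HN] : exists N : nat, beta / 2 * sqnorm w / e <= N%:R.
  by exists (Num.bound (beta / 2 * sqnorm w / e)); apply/ltW/archi_boundP;
    rewrite ?divr_ge0 ?mulr_ge0 ?sqnorm_ge0// ltW.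
exists N => // n /= Nn; apply: le_trans (bnd n) _.
rewrite ler_pdivrMr ?ltr0n// [e * _]mulrC -ler_pdivrMr//; apply: le_trans HN _.
by rewrite ler_nat (leq_trans Nn).
Qed.
End Gradient.

(** * Independence *)

Section Independence.
Context {R : realType} {dO dX dY : measure_display}
  {Omega : measurableType dO} {X : measurableType dX} {Y : measurableType dY}
  {P : probability Omega R} {PX : probability X R}.

(** As functions of [E], both sides are finite measures that agree on the pi-system [G], which
    contains the whole space; hence they agree on the sigma-algebra it generates. *)
Lemma indep_g_sigma_algebra (G : set (set Omega)) (B : set Omega) (p : R) :
    G `<=` measurable -> setI_closed G -> measurable B -> G setT ->
    (forall E, G E -> P (E `&` B) = (P E * p%:E)%E) -> 0 <= p ->
  forall E, <<s G >> E -> P (E `&` B) = (P E * p%:E)%E.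
Proof.
move=> Gm GI mB GT GB p0 E sE.
rewrite muleC.
apply: (@g_sigma_algebra_measure_unique _ R Omega G Gm (fun=> setT) _ _
  (mrestr P mB) (mscale (NngNum p0) P) GI _ _ E sE) => //=.
- by rewrite bigcup_const//; exists 0%N.
- by move=> A GA; rewrite /mrestr/= GB// muleC.
- by move=> _; rewrite /mrestr (le_lt_trans (probability_le1 _ _)) ?ltry ?setTI.
Qed.

Local Open Scope ereal_scope.
Variables (y : Omega -> Y) (x : Omega -> X).
Hypotheses (my : measurable_fun setT y) (mx : measurable_fun setT x).
Hypothesis indep : forall A B, measurable A -> measurable B ->
  P (y @^-1` A `&` x @^-1` B) = P (y @^-1` A) * PX B.

Let ym : {mfun Omega >-> Y} := HB.pack y (isMeasurableFun.Build _ _ _ _ _ my).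

Let yx om := (y om, x om).
Let myx : measurable_fun setT yx. Proof. exact: measurable_fun_pair. Qed.
Let yxm : {mfun Omega >-> (Y * X)%type} := HB.pack yx (isMeasurableFun.Build _ _ _ _ _ myx).

(** By independence both measures agree on rectangles, which determine the product measure. *)
Let distribution_pair (A : set (Y * X)) : measurable A ->
  (distribution P ym \x PX) A = distribution P yxm A.
Proof.
by move=> mA; apply: product_measure_unique => // B C mB mC; exact: indep.
Qed.

(** Pass to the joint law, which is a product, and apply Tonelli. The inner integral, with [y] held
    fixed, plays the role of a conditional expectation. *)
Lemma ge0_integral_indep (h : Y * X -> \bar R) :
    measurable_fun [set: Y * X] h -> (forall z, 0 <= h z) ->
  \int[P]_om h (y om, x om) = \int[P]_om \int[PX]_z h (y om, z).
Proof.
move=> mh h0.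
rewrite -(@ge0_integral_distribution _ _ _ _ _ P yxm h mh h0).
rewrite (eq_measure_integral (distribution P ym \x PX)); last first.
  by move=> A mA _; exact/esym/distribution_pair.
rewrite fubini_tonelli1//.
rewrite (@ge0_integral_distribution _ _ _ _ _ P ym (fubini_F PX h))//.
  exact: measurable_fun_fubini_tonelli_F.
by move=> z; apply: integral_ge0.
Qed.

(** Signed version: Fubini asks for integrability under the product law, which is transferred from
    that of the composite on [Omega]. *)
Lemma integral_indep (h : Y * X -> \bar R) :
    measurable_fun [set: Y * X] h -> P.-integrable setT (fun om => h (y om, x om)) ->
  \int[P]_om h (y om, x om) = \int[P]_om \int[PX]_z h (y om, z).
Proof.
move=> mh ih.
have ihd : (distribution P ym \x PX).-integrable setT h.
  apply/integrableP; split=> //.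
  rewrite (eq_measure_integral (distribution P yxm)); last first.
  by move=> A mA _; exact: distribution_pair.
  rewrite ge0_integral_distribution//; last exact: measurableT_comp.
  by case/integrableP : ih.
rewrite -(@integral_distribution _ _ _ _ _ P yxm h mh ih).
rewrite (eq_measure_integral (distribution P ym \x PX)); last first.
  by move=> A mA _; exact/esym/distribution_pair.
rewrite -integral12_prod_meas1//.
have /integrableP[mF iF] := integrable_fubini_F ihd.
rewrite (@integral_distribution _ _ _ _ _ P ym (fubini_F PX h))//.
apply/integrableP; split; first exact: (measurableT_comp mF my).
rewrite -(@ge0_integral_distribution _ _ _ _ _ P ym (abse \o fubini_F PX h))//.
  exact: (measurableT_comp _ mF).
by move=> z; exact: abse_ge0.
Qed.
End Independence.

(** * The sigma-algebra of all variables but one *)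

Section OtherVariables.
Context {R : realType} {dO dX : measure_display}
  {Omega : measurableType dO} {X : measurableType dX}
  {P : probability Omega R} {PX : probability X R}.
Context {I : choiceType} (x : I -> Omega -> X).

(* [cylinder_but k] is a pi-system generating the sigma-algebra of all the variables other
   than [x k]: it contains the past of batch [k] as well as its sibling batches. *)
Definition cylinder_but (k : I) : set (set Omega) :=
  [set E | exists s A, [/\ uniq s, k \notin s, (forall j, measurable (A j)) &
     E = \big[setI/setT]_(j <- s) (x j @^-1` A j)]].

(** [Omega] retyped with this sigma-algebra, so that [measurable_fun (T := sigma_but k)] expresses
    measurability for the variables other than [x k]. *)
Definition sigma_but (k : I) := g_sigma_algebraType (cylinder_but k).

Lemma cylinder_but_setT k : cylinder_but k setT.
Proof. by exists [::], (fun=> setT); split => //; rewrite big_nil. Qed.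

Lemma setI_closed_cylinder_but k : setI_closed (cylinder_but k).
Proof.
move=> _ _ [s1 [A1 [u1 k1 mA1 ->]]] [s2 [A2 [u2 k2 mA2 ->]]].
(* An index absent from one list gets the constraint [setT], so one family serves the union of both
   lists. *)
pose A j := (if j \in s1 then A1 j else setT) `&` (if j \in s2 then A2 j else setT).
exists (undup (s1 ++ s2)), A; split.
- exact: undup_uniq.
- by rewrite mem_undup mem_cat negb_or k1 k2.
- by move=> j; apply: measurableI; case: ifP.
rewrite -!bigcap_seq; apply/seteqP; split=> om /=.
  move=> [H1 H2] j /=; rewrite mem_undup mem_cat /A => js.
  by split; case: ifP => // js'; [exact: H1|exact: H2].
move=> H; split=> j /= js.
  have /= := H j; rewrite mem_undup mem_cat js /A js => /(_ isT)[].
  by [].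
have /= := H j; rewrite mem_undup mem_cat js orbT /A js => /(_ isT)[].
by [].
Qed.

Hypothesis mx : forall j, measurable_fun setT (x j).

Lemma cylinder_but_measurable k : cylinder_but k `<=` measurable.
Proof.
move=> _ [s [A [_ _ mA ->]]]; elim/big_ind : _ => //; first exact: measurableI.
by move=> j _; rewrite -[X in measurable X]setTI; exact: mx.
Qed.

Lemma measurable_sigma_but k j : j != k ->
  measurable_fun (T := sigma_but k) setT (x j).
Proof.
move=> jk _ B mB; rewrite setTI; apply: sub_sigma_algebra.
exists [:: j], (fun=> B); split => //; first by rewrite inE eq_sym.
by rewrite big_seq1.
Qed.

Lemma measurable_fun_sigma_but d (Y : measurableType d) k (y : Omega -> Y) :
  measurable_fun (T := sigma_but k) setT y -> measurable_fun setT y.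
Proof.
move=> my _ B mB; have := my measurableT B mB.
by apply: smallest_sub (@sigma_algebra_measurable _ _) (@cylinder_but_measurable k) _.
Qed.

Hypothesis indep : forall (s : seq I) (A : I -> set X), uniq s ->
  (forall j, measurable (A j)) ->
  P (\big[setI/setT]_(j <- s) (x j @^-1` A j)) = (\prod_(j <- s) PX (A j))%E.

(** It suffices to treat cylinders, where adding [k] to the index list turns the claim into the
    product formula. *)
Lemma indep_sigma_but d (Y : measurableType d) k (y : Omega -> Y) :
    measurable_fun (T := sigma_but k) setT y ->
  forall A B, measurable A -> measurable B ->
  P (y @^-1` A `&` x k @^-1` B) = (P (y @^-1` A) * PX B)%E.
Proof.
move=> my A B mA mB.
have PXB : PX B = (fine (PX B))%:E by rewrite fineK// fin_num_measure.
rewrite PXB; apply: (@indep_g_sigma_algebra _ _ _ _ (cylinder_but k)).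
- exact: cylinder_but_measurable.
- exact: setI_closed_cylinder_but.
- by rewrite -[X in measurable X]setTI; exact: mx.
- exact: cylinder_but_setT.
- move=> _ [s [C [us ks mC ->]]]; rewrite -PXB.
  pose C' j := if j == k then B else C j.
  have C's j : j \in s -> C' j = C j.
    by rewrite /C'; case: eqP => // ->; rewrite (negbTE ks).
  have C'k : C' k = B by rewrite /C' eqxx.
  have mC' j : measurable (C' j) by rewrite /C'; case: ifP.
  have := indep (k :: s) C'; rewrite /= ks us !big_cons C'k => /(_ isT mC') H.
  rewrite indep// muleC -(eq_big_seq _ (fun j js => congr1 PX (C's j js))) -H setIC.
  congr (P (_ `&` _)); apply: eq_big_seq => j js.
  by rewrite C's.
- by rewrite fine_ge0.
- by have := my measurableT A mA; rewrite setTI.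
Qed.
End OtherVariables.

(** * Means and measurability *)

Section HasMean.
Context {R : realType} {dO : measure_display} {Omega : measurableType dO}
  (P : probability Omega R).
Implicit Types (f h : Omega -> R) (a b : R).

(** Integrability and the value of the mean are kept together, so that expectations are computed
    with real numbers. *)
Definition has_mean f a :=
  P.-integrable setT (EFin \o f) /\ (\int[P]_om (f om)%:E = a%:E)%E.

Lemma has_mean_fine f : P.-integrable setT (EFin \o f) ->
  has_mean f (fine (\int[P]_om (f om)%:E)).
Proof. by move=> fi; split=> //; rewrite fineK// integrable_fin_num. Qed.

Lemma has_meanD f h a b : has_mean f a -> has_mean h b -> has_mean (f \+ h) (a + b).
Proof.
move=> [fi fa] [hi hb]; split.
  by have := integrableD measurableT fi hi; apply: eq_integrable.
by rewrite EFinD -fa -hb -integralD_EFin.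
Qed.

Lemma has_meanZ c f a : has_mean f a -> has_mean (fun om => c * f om) (c * a).
Proof.
move=> [fi fa]; split.
  by have := integrableZl measurableT c fi; apply: eq_integrable.
by rewrite EFinM -fa -integralZl//; apply: eq_integral => om _; rewrite EFinM.
Qed.

Lemma has_mean0 : has_mean (fun=> 0) 0.
Proof. by split; [exact: integrable0|rewrite integral0]. Qed.

Lemma has_mean_sum (J : Type) (s : seq J) (f : J -> Omega -> R) (a : J -> R) :
  (forall j, has_mean (f j) (a j)) ->
  has_mean (fun om => \sum_(j <- s) f j om) (\sum_(j <- s) a j).
Proof.
move=> fa; elim: s => [|j s IHs].
  by rewrite big_nil; under eq_fun do rewrite big_nil; exact: has_mean0.
by rewrite big_cons; under eq_fun do rewrite big_cons; exact: has_meanD.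
Qed.

Lemma has_mean_le f h a b : has_mean f a -> has_mean h b ->
  (forall om, f om <= h om) -> a <= b.
Proof.
move=> [fi fa] [hi hb] fh; rewrite -lee_fin -fa -hb; apply: le_integral => // om _.
by rewrite lee_fin.
Qed.

Lemma has_mean_dominated f h b : measurable_fun setT f -> has_mean h b ->
  (forall om, 0 <= f om <= h om) -> exists a, has_mean f a.
Proof.
move=> mf [hi hb] fh; eexists; apply: has_mean_fine.
apply: le_integrable hi => //; first exact/measurable_EFinP.
move=> om _ /=; have /andP[f0 le] := fh om.
by rewrite lee_fin !ger0_norm// (le_trans f0).
Qed.

(** Domination: [|f h| <= f^2 + h^2]. *)
Lemma has_meanM_fun f h a b : measurable_fun setT f -> measurable_fun setT h ->
  has_mean (fun om => f om ^+ 2) a -> has_mean (fun om => h om ^+ 2) b ->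
  P.-integrable setT (fun om => (f om * h om)%:E).
Proof.
move=> mf mh [fi _] [hi _].
apply: (le_integrable measurableT _ _ (integrableD measurableT fi hi)).
  exact/measurable_EFinP/measurable_funM.
move=> om _ /=; rewrite lee_fin [leRHS]ger0_norm ?addr_ge0 ?sqr_ge0// normrM.
rewrite -(real_normK (num_real (f om))) -(real_normK (num_real (h om))).
have := sqr_ge0 (`|f om| - `|h om|); have := mulr_ge0 (normr_ge0 (f om)) (normr_ge0 (h om)).
nra.
Qed.
End HasMean.

(** * Measurability of random vectors *)

Section RandomVectors.
Context {R : realType} {d : nat}.
Local Notation W := 'rV[R]_d.

Lemma rv2tupleK : cancel (@rv2tuple R d) (@tuple2rv R d).
Proof. by move=> u; apply/rowP => i; rewrite mxE tnth_mktuple. Qed.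

Section MeasurableRV.
Context {dT : measure_display} {T : measurableType dT}.

(** The domain [T] stays general so that it may be [sigma_but k] as well as [Omega]. *)
Definition measurable_rv (w : T -> W) := measurable_fun setT (@rv2tuple R d \o w).

Lemma measurable_rvP (w : T -> W) :
  measurable_rv w <-> forall i, measurable_fun setT (fun om => w om ord0 i).
Proof.
split=> [/measurable_fun_tnthP mw i|mw].
  by apply: eq_measurable_fun (mw i) => om _ /=; rewrite tnth_mktuple.
apply/measurable_fun_tnthP => i.
by apply: eq_measurable_fun (mw i) => om _ /=; rewrite tnth_mktuple.
Qed.

Lemma measurable_rvB (u v : T -> W) : measurable_rv u -> measurable_rv v ->
  measurable_rv (fun om => u om - v om).
Proof.
move=> /measurable_rvP mu /measurable_rvP mv; apply/measurable_rvP => i.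
under eq_fun do rewrite !mxE; exact: measurable_funB.
Qed.

Lemma measurable_rvZ c (u : T -> W) : measurable_rv u ->
  measurable_rv (fun om => c *: u om).
Proof.
move=> /measurable_rvP mu; apply/measurable_rvP => i.
by under eq_fun do rewrite mxE; exact: measurable_funM.
Qed.

Lemma measurable_rv_sum (J : Type) (s : seq J) (u : J -> T -> W) :
  (forall j, measurable_rv (u j)) -> measurable_rv (fun om => \sum_(j <- s) u j om).
Proof.
move=> mu; apply/measurable_rvP => i.
under eq_fun do rewrite summxE.
by apply: measurable_sum => j; move/measurable_rvP : (mu j).
Qed.

Lemma measurable_dotv (u v : T -> W) : measurable_rv u -> measurable_rv v ->
  measurable_fun setT (fun om => dotv (u om) (v om)).
Proof.
move=> /measurable_rvP mu /measurable_rvP mv.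
by apply: measurable_sum => i; exact: measurable_funM.
Qed.
End MeasurableRV.

Lemma measurable_tuple2rv : measurable_rv (@tuple2rv R d).
Proof.
by apply/measurable_rvP => i; under eq_fun do rewrite mxE; exact: measurable_tnth.
Qed.

Lemma measurable_rv_comp {dT} {T : measurableType dT} (h : W -> W) (w : T -> W) :
  measurable_rv (h \o @tuple2rv R d) -> measurable_rv w -> measurable_rv (h \o w).
Proof.
move=> mh mw.
have -> : h \o w = (h \o @tuple2rv R d) \o (@rv2tuple R d \o w).
  by apply/funext => om /=; rewrite rv2tupleK.
exact: measurableT_comp mh mw.
Qed.
End RandomVectors.

(** * Mean and variance of the stochastic gradient *)

Section StochasticGradient.
Context {R : realType} {d : nat} {dX : measure_display} {X : measurableType dX}
  {PX : probability X R}.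
Local Notation W := 'rV[R]_d.
Variables (g : W -> X -> W) (gF : W -> W).
Hypothesis gmean : forall w (i : 'I_d), PX.-integrable setT (fun x => (g w x ord0 i)%:E) /\
  (\int[PX]_x (g w x ord0 i)%:E = (gF w ord0 i)%:E)%E.
Hypothesis mg : measurable_fun setT
  (fun p : d.-tuple R * X => rv2tuple (g (tuple2rv p.1) p.2)).

Lemma measurable_stoch_grad dT (T : measurableType dT) (w : T -> W) (x : T -> X) :
  measurable_rv w -> measurable_fun setT x -> measurable_rv (fun om => g (w om) (x om)).
Proof.
move=> mw mx; have mp := measurable_fun_pair mw mx.
have := measurableT_comp mg mp; apply: eq_measurable_fun => om _ /=.
by rewrite rv2tupleK.
Qed.

(** Each coordinate of [gF] is the integral of the positive part of that coordinate of [g] minus the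
    integral of its negative part; by Tonelli both depend measurably on the point. *)
Lemma measurable_mean_grad : measurable_rv (gF \o @tuple2rv R d).
Proof.
apply/measurable_rvP => k; apply/measurable_EFinP.
pose h (p : d.-tuple R * X) := (g (tuple2rv p.1) p.2 ord0 k)%:E.
have mh : measurable_fun setT h.
  by apply/measurable_EFinP; exact: (measurable_rvP _).1 mg k.
have -> : EFin \o (fun t => (gF \o @tuple2rv R d) t ord0 k) =
    (fun t => fubini_F PX h^\+ t - fubini_F PX h^\- t)%E.
  apply/funext => t /=; rewrite -(gmean _ k).2 integralE /fubini_F.
  by congr (_ - _)%E; apply: eq_integral => x _; rewrite ?funeposE ?funenegE.
apply: emeasurable_funB; apply: measurable_fun_fubini_tonelli_F => //.
  exact: measurable_funepos.
exact: measurable_funeneg.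
Qed.

Lemma measurable_mean_grad_comp dT (T : measurableType dT) (w : T -> W) :
  measurable_rv w -> measurable_rv (fun om => gF (w om)).
Proof. exact: measurable_rv_comp measurable_mean_grad. Qed.

(** [F] is a pointwise limit of Riemann sums of its gradient, which are measurable since [gF] is. *)
Lemma measurable_objective F (beta : R) dT (T : measurableType dT) (w : T -> W) :
    0 <= beta -> is_gradient F gF -> smooth_cond gF beta -> measurable_rv w ->
  measurable_fun setT (F \o w).
Proof.
move=> b0 G sm mw.
apply: (@measurable_fun_cvg _ _ _ _ (fun (n : nat) om => F 0 + \sum_(j < n.+1)
     n.+1%:R^-1 * dotv (gF ((j%:R / n.+1%:R) *: w om)) (w om))); last first.
  by move=> om _; exact: cvg_gradient_riemann_sum b0 G sm.
move=> n; apply: measurable_funD => //; apply: measurable_sum => j.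
apply: measurable_funM => //; apply: measurable_dotv => //.
exact/measurable_mean_grad_comp/measurable_rvZ.
Qed.

(** A diagonal entry of the gradient covariance, as an extended real so that finiteness can be
    settled later. *)
Definition grad_var (w : W) (k : 'I_d) : \bar R :=
  (\int[PX]_x ((g w x ord0 k - gF w ord0 k) ^+ 2)%:E)%E.

Lemma sigma2E w : sigma2 PX g w = (\sum_(k < d) grad_var w k)%E.
Proof.
apply: eq_bigr => k _; rewrite covariance.unlock expectation.unlock.
by apply: eq_integral => x _; rewrite (gmean w k).2.
Qed.

Lemma grad_var_ge0 w k : (0 <= grad_var w k)%E.
Proof. by apply: integral_ge0 => x _; rewrite lee_fin sqr_ge0. Qed.

Lemma measurable_noise k : measurable_fun setT
  (fun p : d.-tuple R * X => g (tuple2rv p.1) p.2 ord0 k - gF (tuple2rv p.1) ord0 k).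
Proof.
apply: measurable_funB; first exact: (measurable_rvP _).1 mg k.
exact: measurableT_comp ((measurable_rvP _).1 measurable_mean_grad k) measurable_fst.
Qed.

Lemma measurable_grad_var dT (T : measurableType dT) (w : T -> W) k :
  measurable_rv w -> measurable_fun setT (fun om => grad_var (w om) k).
Proof.
move=> mw.
pose h (p : d.-tuple R * X) :=
  ((g (tuple2rv p.1) p.2 ord0 k - gF (tuple2rv p.1) ord0 k) ^+ 2)%:E.
have mh : measurable_fun setT (fubini_F PX h).
  apply: measurable_fun_fubini_tonelli_F; last by move=> p; rewrite lee_fin sqr_ge0.
  by apply/measurable_EFinP; apply: measurable_funX; exact: measurable_noise.
have := measurableT_comp mh mw; apply: eq_measurable_fun => om _ /=.
by rewrite /fubini_F /h /= rv2tupleK.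
Qed.
End StochasticGradient.

Arguments grad_var {R d dX X} PX g gF w k.

(** * One stochastic gradient step *)

Section OneStep.
Context {R : realType} {d : nat} {dX dO : measure_display}
  {X : measurableType dX} {Omega : measurableType dO}
  {PX : probability X R} {P : probability Omega R}.
Local Notation W := 'rV[R]_d.
Variables (g : W -> X -> W) (gF : W -> W).
Hypothesis gmean : forall w (i : 'I_d), PX.-integrable setT (fun x => (g w x ord0 i)%:E) /\
  (\int[PX]_x (g w x ord0 i)%:E = (gF w ord0 i)%:E)%E.
Hypothesis mg : measurable_fun setT
  (fun p : d.-tuple R * X => rv2tuple (g (tuple2rv p.1) p.2)).
Context {I : choiceType} (x : I -> Omega -> X).
Hypothesis mx : forall j, measurable_fun setT (x j).
Hypothesis indep : forall (s : seq I) (A : I -> set X), uniq s ->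
  (forall j, measurable (A j)) ->
  P (\big[setI/setT]_(j <- s) (x j @^-1` A j)) = (\prod_(j <- s) PX (A j))%E.
Variable w : Omega -> W.

Definition noise (j : I) (c : 'I_d) (om : Omega) : R :=
  g (w om) (x j om) ord0 c - gF (w om) ord0 c.

Lemma measurable_noise_rv dT (T : measurableType dT) (w' : T -> W) (x' : T -> X) c :
  measurable_rv w' -> measurable_fun setT x' ->
  measurable_fun setT (fun om => g (w' om) (x' om) ord0 c - gF (w' om) ord0 c).
Proof.
move=> mw mx'; apply: measurable_funB.
  exact: (measurable_rvP _).1 (measurable_stoch_grad _ mg _ _ _ _ mw mx') c.
exact: (measurable_rvP _).1 (measurable_mean_grad_comp _ _ gmean mg _ _ _ mw) c.
Qed.

(** Given the variables other than [x j], both [U] and [w] are fixed, and the noise averages to zero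
    over [x j]. *)
Lemma noise_mul_mean0 j c (U : Omega -> R) :
    measurable_rv (T := sigma_but x j) w ->
    measurable_fun (T := sigma_but x j) setT U ->
    P.-integrable setT (fun om => (U om * noise j c om)%:E) ->
  has_mean P (fun om => U om * noise j c om) 0.
Proof.
move=> mw mU iU; split=> //.
(* Bundling [U] and [w] lets independence from [x j] be used once, for the pair. *)
pose y om := (U om, rv2tuple (w om)).
have my : measurable_fun (T := sigma_but x j) setT y by exact: measurable_fun_pair.
pose h (p : (R * d.-tuple R) * X) :=
  (p.1.1 * (g (tuple2rv p.1.2) p.2 ord0 c - gF (tuple2rv p.1.2) ord0 c))%:E.
have mh : measurable_fun setT h.
  apply/measurable_EFinP; apply: measurable_funM.
    exact: measurableT_comp measurable_fst measurable_fst.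
  apply: (measurable_noise_rv _ _ (fun p : (R * d.-tuple R) * X => tuple2rv p.1.2)) => //.
  have m2 : measurable_fun setT (fun p : (R * d.-tuple R) * X => p.1.2).
    exact: measurableT_comp measurable_snd measurable_fst.
  exact: measurableT_comp measurable_tuple2rv m2.
have hE om : h (y om, x j om) = (U om * noise j c om)%:E.
  by rewrite /h /= rv2tupleK.
under eq_integral do rewrite -hE.
rewrite (@integral_indep _ _ _ _ _ _ _ P PX y (x j) _ _ _ h)//.
- apply: integral0_eq => om _; rewrite /h /= rv2tupleK.
  under eq_integral do rewrite EFinM EFinB.
  have [gi gE] := gmean (w om) c.
  rewrite integralZl//; last by apply: integrableB => //; exact: finite_measure_integrable_cst.
  rewrite integralB//; last exact: finite_measure_integrable_cst.
  by rewrite gE integral_cst//= probability_setT mule1 subee// mule0.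
- exact: (measurable_fun_sigma_but x mx _ _ j y my).
- exact: (indep_sigma_but x mx indep _ _ j y my).
- by apply: eq_integrable iU => // om _; rewrite hE.
Qed.

Lemma integral_noise_sq j c : measurable_rv (T := sigma_but x j) w ->
  (\int[P]_om (noise j c om ^+ 2)%:E = \int[P]_om grad_var PX g gF (w om) c)%E.
Proof.
move=> mw.
pose h (p : d.-tuple R * X) :=
  ((g (tuple2rv p.1) p.2 ord0 c - gF (tuple2rv p.1) ord0 c) ^+ 2)%:E.
have mh : measurable_fun setT h.
  by apply/measurable_EFinP; apply: measurable_funX; exact: (measurable_noise _ _ gmean mg).
have hE om : h (rv2tuple (w om), x j om) = (noise j c om ^+ 2)%:E.
  by rewrite /h /= rv2tupleK.
under eq_integral do rewrite -hE.
have my := measurable_fun_sigma_but x mx _ _ j _ mw.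
have yx := indep_sigma_but x mx indep _ _ j _ mw.
have h0 z : (0 <= h z)%E by rewrite lee_fin sqr_ge0.
rewrite (ge0_integral_indep _ _ my (mx j) yx h mh h0).
by apply: eq_integral => om _; rewrite /h /= rv2tupleK.
Qed.

Context {S : nat} (idx : 'I_S -> I).
Hypotheses (S_gt0 : (0 < S)%N) (idx_inj : injective idx).
Hypothesis mw : forall i, measurable_rv (T := sigma_but x (idx i)) w.
Variable v : 'I_d -> R.
Hypothesis vE : forall c, (\int[P]_om grad_var PX g gF (w om) c = (v c)%:E)%E.

Let i0 : 'I_S := Ordinal S_gt0.

Lemma measurable_rv_iterate : measurable_rv w.
Proof. exact: (measurable_fun_sigma_but x mx _ _ (idx i0) _ (mw i0)). Qed.

Let mwO := measurable_rv_iterate.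

Let mnoise i c : measurable_fun setT (noise (idx i) c).
Proof. exact: measurable_noise_rv. Qed.

Lemma has_mean_noise_sq i c : has_mean P (fun om => noise (idx i) c om ^+ 2) (v c).
Proof.
have E : (\int[P]_om (noise (idx i) c om ^+ 2)%:E = (v c)%:E)%E.
  by rewrite integral_noise_sq// vE.
split=> //; apply/integrableP; split.
  by apply/measurable_EFinP; exact: measurable_funX.
under eq_integral do rewrite /= ger0_norm ?sqr_ge0//.
by rewrite E ltry.
Qed.

(** For [i != j] the noise of batch [idx i] is measurable for the variables other than [x (idx j)],
    so it can serve as [U] in [noise_mul_mean0]. *)
Lemma has_mean_noise_mul i j c :
  has_mean P (fun om => noise (idx i) c om * noise (idx j) c om) (if i == j then v c else 0).
Proof.
have [->|ij] := eqVneq i j.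
  by under eq_fun do rewrite -expr2; exact: has_mean_noise_sq.
apply: noise_mul_mean0 => //.
  apply: measurable_noise_rv => //; apply: measurable_sigma_but.
  by apply: contra ij => /eqP/idx_inj->.
exact: (has_meanM_fun _ _ _ _ _ (mnoise i c) (mnoise j c)
  (has_mean_noise_sq i c) (has_mean_noise_sq j c)).
Qed.

Variable m : R.
Hypothesis mE : has_mean P (fun om => mu2 gF (w om)) m.

Lemma has_mean_grad_mul_noise i c :
  has_mean P (fun om => gF (w om) ord0 c * noise (idx i) c om) 0.
Proof.
have mgF dT (T : measurableType dT) (w' : T -> W) : measurable_rv w' ->
    measurable_fun setT (fun om => gF (w' om) ord0 c).
  move=> mw'; exact: (measurable_rvP _).1 (measurable_mean_grad_comp _ _ gmean mg _ _ _ mw') c.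
(* One squared coordinate is dominated by the whole squared norm, whose mean is finite. *)
have [||b hb] := has_mean_dominated P (fun om => gF (w om) ord0 c ^+ 2) _ _ _ mE.
- by apply: measurable_funX; exact: mgF.
- move=> om; rewrite sqr_ge0/= /mu2 /sqnorm /dotv (bigD1 c)//= -expr2 lerDl.
  by apply: sumr_ge0 => k _; rewrite -expr2 sqr_ge0.
apply: noise_mul_mean0 => //; first exact: mgF.
exact: (has_meanM_fun _ _ _ _ _ (mgF _ _ _ mwO) (mnoise i c) hb (has_mean_noise_sq i c)).
Qed.

Let ebar om := S%:R^-1 *: (\sum_(i < S) g (w om) (x (idx i) om)) - gF (w om).

Let S0 : S%:R != 0 :> R. Proof. by rewrite pnatr_eq0 -lt0n. Qed.

Let ebarE om c : ebar om ord0 c = S%:R^-1 * \sum_(i < S) noise (idx i) c om.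
Proof.
rewrite !mxE summxE /noise sumrB sumr_const card_ord mulrBr -[gF _ _ _ *+ S]mulr_natl.
by rewrite mulKf.
Qed.

(** In each coordinate the square expands into [S^2] noise products, of which only the [S] diagonal
    ones can have a nonzero mean; the prefactor [1 / S^2] leaves [1 / S]. *)
Lemma has_mean_sqnorm_ebar : has_mean P (fun om => sqnorm (ebar om)) (S%:R^-1 * \sum_c v c).
Proof.
have -> : (fun om => sqnorm (ebar om)) = (fun om => S%:R^-1 * (S%:R^-1 *
    \sum_c \sum_i \sum_j noise (idx i) c om * noise (idx j) c om)).
  apply/funext => om; rewrite !mulr_sumr; apply: eq_bigr => c _.
  rewrite ebarE mulrACA mulr_suml -mulrA; congr (_ * (_ * _)).
  by apply: eq_bigr => i _; rewrite mulr_sumr.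
have -> : S%:R^-1 * \sum_c v c = S%:R^-1 * (S%:R^-1 *
    \sum_c \sum_(i < S) \sum_(j < S) if i == j then v c else 0).
  congr (_ * _); rewrite [in RHS]mulr_sumr; apply: eq_bigr => c _.
  rewrite (eq_bigr (fun=> v c)) => [|i _]; last first.
    by rewrite -big_mkcond (big_pred1 i)// => j; rewrite eq_sym.
  by rewrite sumr_const card_ord -[v c *+ _]mulr_natl mulKf.
do 2!apply: has_meanZ.
apply: has_mean_sum => c; apply: has_mean_sum => i; apply: has_mean_sum => j.
exact: has_mean_noise_mul.
Qed.

Lemma has_mean_dotv_ebar : has_mean P (fun om => dotv (gF (w om)) (ebar om)) 0.
Proof.
have -> : (fun om => dotv (gF (w om)) (ebar om)) = (fun om => S%:R^-1 *
    \sum_c \sum_i gF (w om) ord0 c * noise (idx i) c om).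
  apply/funext => om; rewrite mulr_sumr; apply: eq_bigr => c _.
  by rewrite ebarE mulrCA mulr_sumr.
have := has_meanZ P S%:R^-1 _ _ (has_mean_sum P _ (index_enum 'I_d) _ _ (fun c =>
  has_mean_sum P _ (index_enum 'I_S) _ _ (fun i => has_mean_grad_mul_noise i c))).
by rewrite [X in _ * X]big1 ?mulr0// => c _; rewrite big1.
Qed.

Lemma expected_descent F (Fstar beta a D : R) : 0 <= beta ->
    is_gradient F gF -> smooth_cond gF beta -> (forall u, Fstar <= F u) ->
    has_mean P (fun om => F (w om) - Fstar) D ->
  exists2 D', has_mean P (fun om =>
      F (w om - a *: (S%:R^-1 *: \sum_(i < S) g (w om) (x (idx i) om))) - Fstar) D' &
    D' <= D - a * m + beta / 2 * a ^+ 2 * (m + S%:R^-1 * \sum_c v c).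
Proof.
move=> b0 G sm Fs hD.
(* [Q] is the descent bound for the step [- a *: (gF + ebar)], expanded into summands of known
   mean. *)
pose Q om := (F (w om) - Fstar) + ((beta / 2 * a ^+ 2 - a) * mu2 gF (w om) +
  (beta / 2 * a ^+ 2 * sqnorm (ebar om) + (beta * a ^+ 2 - a) * dotv (gF (w om)) (ebar om))).
have hQ := has_meanD _ _ _ _ _ hD (has_meanD _ _ _ _ _ (has_meanZ _ (beta / 2 * a ^+ 2 - a) _ _ mE)
  (has_meanD _ _ _ _ _ (has_meanZ _ (beta / 2 * a ^+ 2) _ _ has_mean_sqnorm_ebar)
     (has_meanZ _ (beta * a ^+ 2 - a) _ _ has_mean_dotv_ebar))).
have mgb : measurable_rv (fun om => w om - a *: (S%:R^-1 *: \sum_(i < S) g (w om) (x (idx i) om))).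
  apply: measurable_rvB => //; do 2!apply: measurable_rvZ.
  by apply: measurable_rv_sum => i; exact: measurable_stoch_grad.
(* Lying between 0 and the integrable [Q], the next gap has a finite mean too. *)
have le om : 0 <= F (w om - a *: (S%:R^-1 *: \sum_(i < S) g (w om) (x (idx i) om))) - Fstar <= Q om.
  rewrite subr_ge0 Fs/=.
  have -> : S%:R^-1 *: (\sum_(i < S) g (w om) (x (idx i) om)) = gF (w om) + ebar om.
    by rewrite addrC subrK.
  rewrite -scaleNr /Q /mu2; move: (ebar om) => e.
  have := smooth_upper_bound F gF beta (w om) (- a *: (gF (w om) + e)) b0 G sm.
  rewrite /sqnorm dotvZl !dotvZr dotvDl !dotvDr (dotvC e) -!/(sqnorm _).
  lra.
have [|D' hD'] := has_mean_dominated P _ _ _ _ hQ le.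
  apply: measurable_funB => //.
  exact: (measurable_objective _ _ gmean mg F beta _ _ _ b0 G sm mgb).
exists D' => //; have := has_mean_le _ _ _ _ _ hD' hQ (fun om => (andP (le om)).2).
lra.
Qed.
End OneStep.

(** * AdaScale *)

Lemma bernoulli_powR {R : realType} (x r : R) : 0 <= x -> 1 <= r ->
  1 + r * (x - 1) <= x `^ r.
Proof.
move=> x0; rewrite le_eqVlt => /orP[/eqP<-|r1]; first by rewrite powRr1//; lra.
have r0 : 0 < r by lra.
have s0 : 0 < r - 1 by lra.
have q0 : 0 < r / (r - 1) by rewrite divr_gt0.
have e : r^-1 + (r / (r - 1))^-1 = 1 by field; rewrite !gt_eqF.
(* Young's inequality with the conjugate exponents [r] and [r / (r - 1)] *)
have := conjugate_powR x0 ler01 r0 q0 e.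
rewrite powR1 mulr1 div1r => H.
have {}H := ler_wpM2l (ltW r0) H.
have e' : r * (x `^ r / r + (r / (r - 1))^-1) = x `^ r + (r - 1).
  by field; rewrite !gt_eqF.
by rewrite e' in H; lra.
Qed.

Lemma gain_ratioP {R : realType} (s m n : R) : 0 <= s -> 0 <= m -> 1 <= n ->
  let r := gain_ratio (s + m)%:E (n^-1 * s + m)%:E in
  [/\ 1 <= r, r <= n & r * (n^-1 * s + m) = s + m].
Proof.
move=> s0 m0 n1; rewrite /gain_ratio /= lte_fin ltry andbT.
have n0 : 0 < n by lra.
have ns : n^-1 * s <= s by rewrite ler_piMl// invf_le1.
have ns0 : 0 <= n^-1 * s by rewrite mulr_ge0// invr_ge0 ltW.
case: ifPn => [den0|]; last first.
  (* A vanishing denominator forces [s = m = 0], and the default ratio 1 keeps the identity. *)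
  rewrite -leNgt => den0; split=> //.
  have s'0 : n^-1 * s = 0 by lra.
  have : n * (n^-1 * s) = 0 by rewrite s'0 mulr0.
  by rewrite mulVKf ?gt_eqF// => ?; lra.
split; last by rewrite divfK// gt_eqF.
- by rewrite ler_pdivlMr//; lra.
- rewrite ler_pdivrMr// mulrDr mulVKf ?gt_eqF// lerD2l ler_peMl//.
Qed.

Section AdaScale.
Context {R : realType} {d : nat} {dX dO : measure_display}
  {X : measurableType dX} {Omega : measurableType dO}
  {PX : probability X R} {P : probability Omega R}.
Local Notation W := 'rV[R]_d.
Variables (F : W -> R) (g : W -> X -> W) (gF : W -> W).
Variables (Fstar alpha beta V eta : R) (S : nat) (w0 : W).
Variable xb : nat -> 'I_S -> Omega -> X.
Hypothesis grad : is_gradient F gF.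
Hypothesis gmean : forall w (i : 'I_d), PX.-integrable setT (fun x => (g w x ord0 i)%:E) /\
  (\int[PX]_x (g w x ord0 i)%:E = (gF w ord0 i)%:E)%E.
Hypothesis mg : measurable_fun setT
  (fun p : d.-tuple R * X => rv2tuple (g (tuple2rv p.1) p.2)).
Hypothesis Fmin : forall w, Fstar <= F w.
Hypotheses (alpha_gt0 : 0 < alpha) (PL : PL_cond F gF Fstar alpha).
Hypotheses (beta_gt0 : 0 < beta) (sm : smooth_cond gF beta).
Hypotheses (V_ge0 : 0 <= V) (varV : forall w, (sigma2 PX g w <= V%:E)%E).
Hypotheses (eta_gt0 : 0 < eta) (eta_lt : eta < 2 / beta).
Let gamma := eta * alpha * (2 - eta * beta).
Let Delta := (2 * gamma)^-1 * (eta ^+ 2 * beta * V).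
Hypotheses (S_gt0 : (0 < S)%N) (S_le : S%:R <= gamma^-1).
Hypothesis iid : iid_batches PX P xb.
Let lr := fun _ : nat => eta.
Let w := adascale_w PX P lr g gF xb w0.
Let tau := adascale_tau PX P lr g gF xb w0.
Let r := adascale_rt PX P lr g gF xb w0.

(** Batches indexed by pairs of time and position, to fit the single index type of the independence
    lemmas. *)
Let xk (k : nat * 'I_S) := xb k.1 k.2.
Let mxk k : measurable_fun setT (xk k). Proof. exact: iid.1. Qed.

Let tauS t : tau t.+1 = tau t + r t. Proof. by []. Qed.

Lemma adascale_tauE T : tau T = \sum_(t < T) r t.
Proof. by elim: T => [|T IHT]; rewrite ?big_ord0// big_ord_recr/= -IHT. Qed.

(** Only batches drawn before time [t] enter [w t], and [k] is not among them; the gain ratios are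
    deterministic. *)
Lemma measurable_adascale_w t (k : nat * 'I_S) : (t <= k.1)%N ->
  measurable_rv (T := sigma_but xk k) (w t).
Proof.
elim: t => [_|t IHt tk]; first by apply/measurable_rvP => i; exact: measurable_cst.
have mwt := IHt (ltnW tk).
have -> : w t.+1 = (fun om =>
    w t om - (r t * eta) *: (S%:R^-1 *: \sum_(i < S) g (w t om) (xk (t, i) om))).
  by apply/funext => om.
apply: measurable_rvB => //; do 2!apply: measurable_rvZ.
apply: measurable_rv_sum => i; apply: measurable_stoch_grad => //.
by apply: measurable_sigma_but; apply: contraTneq tk => <-; rewrite /= ltnn.
Qed.

(** Bounded variance makes the expectations in the gain ratio finite, which brings it to the real
    form treated by [gain_ratioP]. *)
Lemma gain_ratio_moments (wt : Omega -> W) m : measurable_rv wt ->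
    has_mean P (fun om => mu2 gF (wt om)) m ->
  exists2 v : 'I_d -> R,
    forall c, (\int[P]_om grad_var PX g gF (wt om) c = (v c)%:E)%E &
    [/\ 0 <= \sum_c v c, \sum_c v c <= V &
      adascale_r PX P S g gF wt =
        gain_ratio (\sum_c v c + m)%:E (S%:R^-1 * \sum_c v c + m)%:E].
Proof.
move=> mwt hm.
pose v c := fine (\int[P]_om grad_var PX g gF (wt om) c)%E.
have mgv c := measurable_grad_var _ _ gmean mg _ _ _ c mwt.
have gv0 c om : (0 <= grad_var PX g gF (wt om) c)%E by exact: grad_var_ge0.
have gvV c om : (grad_var PX g gF (wt om) c <= V%:E)%E.
  apply: le_trans (varV (wt om)); rewrite (sigma2E _ _ gmean) (bigD1 c)//=.
  by rewrite leeDl// sume_ge0// => j _; exact: gv0.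
have ivV (h : Omega -> \bar R) : measurable_fun setT h -> (forall om, 0 <= h om)%E ->
    (forall om, h om <= V%:E)%E -> (\int[P]_om h om <= V%:E)%E.
  move=> mh h0 hV; apply: (@le_trans _ _ (\int[P]_om (cst V%:E) om)%E).
    by apply: ge0_le_integral.
  by rewrite integral_cst//= probability_setT mule1.
have vE c : (\int[P]_om grad_var PX g gF (wt om) c = (v c)%:E)%E.
  rewrite fineK// ge0_fin_numE ?integral_ge0//.
  by apply: le_lt_trans (ivV _ _ _ _) (ltry V).
have sE : (\int[P]_om sigma2 PX g (wt om) = (\sum_c v c)%:E)%E.
  under eq_integral do rewrite (sigma2E _ _ gmean).
  by rewrite ge0_integral_sum// -sumEFin; apply: eq_bigr => c _; rewrite vE.
have ms : measurable_fun setT (fun om => sigma2 PX g (wt om)).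
  by under eq_fun do rewrite (sigma2E _ _ gmean); exact: emeasurable_sum.
have s0 om : (0 <= sigma2 PX g (wt om))%E.
  by rewrite (sigma2E _ _ gmean) sume_ge0.
have mm : measurable_fun setT (fun om => (mu2 gF (wt om))%:E).
  apply/measurable_EFinP/measurable_dotv;
    exact: (measurable_mean_grad_comp _ _ gmean mg _ _ _ mwt).
have m0 om : (0 <= (mu2 gF (wt om))%:E)%E by rewrite lee_fin sqnorm_ge0.
have iS0 : (0 <= (S%:R^-1)%:E :> \bar R)%E by rewrite lee_fin invr_ge0.
exists v => //; split.
- by rewrite -lee_fin -sE integral_ge0.
- by rewrite -lee_fin -sE ivV.
rewrite /adascale_r !ge0_integralD//.
- by rewrite ge0_integralZr// sE hm.2 -EFinM -!EFinD [_ * S%:R^-1]mulrC.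
- by move=> om _; rewrite mule_ge0.
- exact: emeasurable_funM.
Qed.

Let gamma_gt0 : 0 < gamma.
Proof.
rewrite /gamma !mulr_gt0// subr_gt0.
by rewrite -ltr_pdivlMr.
Qed.

Lemma adascale_invariant t : [/\ t%:R <= tau t, 1 <= r t & exists2 D,
  has_mean P (fun om => F (w t om) - Fstar) D &
  D <= (1 - gamma) `^ (tau t) * (F w0 - Fstar) + Delta].
Proof.
have mu2_mean u D : measurable_rv u -> has_mean P (fun om => F (u om) - Fstar) D ->
    exists m, has_mean P (fun om => mu2 gF (u om)) m.
  move=> mu hD; apply: (has_mean_dominated P _ _ _ _ (has_meanZ _ (2 * beta) _ _ hD)).
    by apply: measurable_dotv; exact: (measurable_mean_grad_comp _ _ gmean mg _ _ _ mu).
  move=> om; rewrite sqnorm_ge0/=.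
  exact: (sqnorm_gradient_le _ _ _ _ _ beta_gt0 grad sm Fmin).
have Sge1 : 1 <= S%:R :> R by rewrite ler1n.
(* With [r <= S] this makes the contraction factor [1 - r * gamma] nonnegative; with [1 <= S] it
   does so for the base [1 - gamma]. *)
have Sgamma : S%:R * gamma <= 1.
  by rewrite -ler_pdivlMr// div1r.
have gamma_le1 : gamma <= 1 by have := ler_wpM2r (ltW gamma_gt0) Sge1; lra.
have mw s : measurable_rv (w s).
  exact: (measurable_fun_sigma_but xk mxk _ _ (s, Ordinal S_gt0) _
    (measurable_adascale_w s (s, Ordinal S_gt0) (leqnn _))).
have rP s D : has_mean P (fun om => F (w s om) - Fstar) D -> [/\ 1 <= r s, r s * gamma <= 1 &
    exists2 D', has_mean P (fun om => F (w s.+1 om) - Fstar) D' &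
      D' - Delta <= (1 - r s * gamma) * (D - Delta)].
  move=> hD; have [m hm] := mu2_mean _ _ (mw s) hD.
  have [v vE [v0 vV rE]] := gain_ratio_moments _ _ (mw s) hm.
  have m_ge0 : 0 <= m.
    by apply: has_mean_le (has_mean0 P) hm _ => om; exact: sqnorm_ge0.
  have [r1 rS rden] := gain_ratioP _ _ _ v0 m_ge0 Sge1.
  have {}rE : r s = gain_ratio (\sum_c v c + m)%:E (S%:R^-1 * \sum_c v c + m)%:E := rE.
  rewrite -rE in r1 rS rden.
  split=> //; first by apply: le_trans Sgamma; rewrite ler_pM2r.
  have idx_inj : injective (pair s : 'I_S -> nat * 'I_S) by move=> i j [].
  have [D' hD' leD'] := expected_descent _ _ gmean mg xk mxk iid.2 (w s) (pair s) S_gt0 idx_inj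
    (fun i => measurable_adascale_w s (s, i) (leqnn _)) v vE m hm F Fstar beta (r s * eta) D
    (ltW beta_gt0) grad sm Fmin hD.
  exists D' => //.
  have mD : 2 * alpha * D <= m.
    apply: has_mean_le (has_meanZ _ (2 * alpha) _ _ hD) hm _ => om.
    have := ler_wpM2l (ltW (mulr_gt0 (ltr0Sn R 1) alpha_gt0)) (PL (w s om)).
    by rewrite mulVKf// gt_eqF// mulr_gt0.
  (* Per unit of gain the noise adds at most [gamma * Delta], which makes [Delta] the fixed point of
     the recursion. *)
  have gD : gamma * Delta = eta ^+ 2 * beta * V / 2.
    by rewrite /Delta; field; rewrite gt_eqF.
  (* The identity [rden] absorbs one of the two factors [r s] and removes [S]. *)
  have eD : beta / 2 * (r s * eta) ^+ 2 * (m + S%:R^-1 * \sum_c v c) =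
      beta / 2 * r s * eta ^+ 2 * (\sum_c v c + m).
    by rewrite -rden; ring.
  rewrite eD in leD'.
  have r0 : 0 <= r s by lra.
  (* This is the coefficient of [- m] in the bound; as it is nonnegative, [m] may be replaced by its
     lower bound [2 * alpha * D]. *)
  have c0 : 0 <= r s * eta * (1 - eta * beta / 2).
    apply: mulr_ge0; first by rewrite mulr_ge0// ltW.
    by have := eta_lt; rewrite ltr_pdivlMr//; lra.
  have h1 := ler_wpM2l c0 mD.
  have h2 : beta / 2 * r s * eta ^+ 2 * (\sum_c v c) <= beta / 2 * r s * eta ^+ 2 * V.
    by apply: ler_wpM2l vV; rewrite !mulr_ge0 ?sqr_ge0 ?invr_ge0// ltW.
  have h3 : r s * (gamma * Delta) = r s * (eta ^+ 2 * beta * V / 2) by rewrite gD.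
  have h4 : r s * eta * (1 - eta * beta / 2) * (2 * alpha * D) = r s * gamma * D.
    by rewrite /gamma; field.
  lra.
have D0 : 0 <= F w0 - Fstar by rewrite subr_ge0.
have Delta0 : 0 <= Delta.
  have g0 := ltW gamma_gt0; have b0 := ltW beta_gt0.
  apply: mulr_ge0; first by rewrite invr_ge0 mulr_ge0.
  by apply: mulr_ge0 => //; apply: mulr_ge0 => //; exact: sqr_ge0.
(* [1 <= r t] follows from the finite mean at time [t], so the induction carries only the other two
   claims. *)
suff: t%:R <= tau t /\ exists2 D, has_mean P (fun om => F (w t om) - Fstar) D &
  D <= (1 - gamma) `^ (tau t) * (F w0 - Fstar) + Delta.
  by case=> tt [D hD leD]; have [r1 _ _] := rP _ _ hD; split => //; exists D.
elim: t => [|t [ttau [D hD leD]]].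
  split=> //; exists (F w0 - Fstar); last by rewrite powRr0 mul1r lerDl.
  split; first exact: (finite_measure_integrable_cst P (F w0 - Fstar)).
  have := integral_cst P measurableT (F w0 - Fstar)%:E.
  by rewrite /= probability_setT mule1.
have [r1 rg [D' hD' leD']] := rP _ _ hD.
rewrite tauS -natr1; split; first exact: lerD.
exists D' => //.
(* A positive total exponent lets the power split even when [1 - gamma] is 0. *)
have tr0 : 0 < tau t + r t.
  by apply: ltr_wpDl; [exact: le_trans ttau|exact: lt_le_trans r1].
rewrite powRD ?(gt_eqF tr0)//.
have := bernoulli_powR (1 - gamma) (r t) _ r1; rewrite subr_ge0 => /(_ gamma_le1) B.
have p0 : 0 <= (1 - gamma) `^ tau t * (F w0 - Fstar) by rewrite mulr_ge0// powR_ge0.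
have c0 : 0 <= 1 - r t * gamma by lra.
(* The induction hypothesis is scaled by a nonnegative factor, which Bernoulli then bounds by a
   power in [h2]. *)
have h1 : (1 - r t * gamma) * (D - Delta) <=
    (1 - r t * gamma) * ((1 - gamma) `^ tau t * (F w0 - Fstar)).
  by apply: ler_wpM2l => //; lra.
have h2 : (1 - r t * gamma) * ((1 - gamma) `^ tau t * (F w0 - Fstar)) <=
    (1 - gamma) `^ r t * ((1 - gamma) `^ tau t * (F w0 - Fstar)).
  by apply: ler_wpM2r => //; lra.
lra.
Qed.
End AdaScale.

Theorem theorem2 (R : realType) (d : nat)
    (dX : measure_display) (X : measurableType dX) (PX : probability X R)
    (dO : measure_display) (Omega : measurableType dO) (P : probability Omega R)
    (f : 'rV[R]_d -> X -> R) (F : 'rV[R]_d -> R)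
    (g : 'rV[R]_d -> X -> 'rV[R]_d) (gF : 'rV[R]_d -> 'rV[R]_d)
    (Fstar alpha beta V eta TSI : R) (S : nat) (w0 : 'rV[R]_d)
    (xb : nat -> 'I_S -> Omega -> X) :
  (* F(w) = E_{x ~ X}[f(w,x)] *)
  (forall w, PX.-integrable setT (fun x => (f w x)%:E) /\
             (\int[PX]_x (f w x)%:E = (F w)%:E)%E) ->
  (* f(., x) and F differentiable, with gradients g(., x) and gF *)
  (forall x, is_gradient (fun w => f w x) (fun w => g w x)) ->
  is_gradient F gF ->
  (* E_{x ~ X}[grad_w f(w,x)] = grad F(w) *)
  (forall w (i : 'I_d), PX.-integrable setT (fun x => (g w x ord0 i)%:E) /\
             (\int[PX]_x (g w x ord0 i)%:E = (gF w ord0 i)%:E)%E) ->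
  (* regularity: (w, x) |-> grad_w f(w,x) is jointly measurable *)
  measurable_fun setT
    (fun p : d.-tuple R * X => rv2tuple (g (tuple2rv p.1) p.2)) ->
  (* F^* = min_w F(w) *)
  (forall w, Fstar <= F w) -> (exists w, F w = Fstar) ->
  0 < alpha -> PL_cond F gF Fstar alpha ->
  0 < beta -> smooth_cond gF beta ->
  0 <= V -> (forall w, (sigma2 PX g w <= V%:E)%E) ->
  0 < eta -> eta < 2 / beta ->
  let gamma := eta * alpha * (2 - eta * beta) in
  let Delta := (2 * gamma)^-1 * (eta ^+ 2 * beta * V) in
  (0 < S)%N -> S%:R <= gamma^-1 ->
  0 < TSI ->
  iid_batches PX P xb ->
  let lr := fun _ : nat => eta in
  (exists T, adascale_stops_at PX P lr g gF xb w0 TSI T) /\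
  forall T : nat, adascale_stops_at PX P lr g gF xb w0 TSI T ->
    let rbar := (\sum_(t < T) adascale_rt PX P lr g gF xb w0 t) / T%:R in
    (\int[P]_om ((F (adascale_w PX P lr g gF xb w0 T om) - Fstar)%:E)
      <= ((1 - gamma) `^ (rbar * T%:R) * (F w0 - Fstar) + Delta)%:E)%E.

Proof.
move=> _ _ grad gmean mg Fmin _ alpha0 PL beta0 sm V0 varV eta0 eta_lt gamma Delta.
move=> S0 S_le TSI0 iid lr.
have inv := adascale_invariant F g gF Fstar alpha beta V eta S w0 xb grad gmean mg Fmin
  alpha0 PL beta0 sm V0 varV eta0 eta_lt S0 S_le iid.
pose tau := adascale_tau PX P lr g gF xb w0.
split.
  (* The loop stops because [tau T] is at least [T]; the least [T] with [TSI <= tau T] is the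
     stopping time. *)
  have ex : exists T, TSI <= tau T.
    exists (Num.bound TSI); have [tt _ _] := inv (Num.bound TSI).
    by apply: le_trans tt; apply/ltW/archi_boundP/ltW.
  case: (ex_minnP ex) => T TT Tmin; exists T; split=> // t tT.
  by rewrite ltNge; apply: contraTN tT => /Tmin; rewrite -leqNgt.
(* [tau 0 = 0 < TSI] excludes [T = 0], so the division in [rbar] cancels and the exponent is
   [tau T]. *)
move=> T [TT _]; cbv zeta; have T0 : (0 < T)%N.
  by rewrite lt0n; apply: contraTneq TT => ->; rewrite -ltNge.
have [_ _ [D [_ ->] leD]] := inv T.
by rewrite lee_fin divfK ?pnatr_eq0 -?lt0n// -adascale_tauE.
Qed.
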